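(* Let $\mathcal D$ be a closed continuum (compact connected set) contained in the open unit disk $\mathbb D$, and for each $q$ let $\eta_{q1},\dots,\eta_{qq}$ denote $q$-th Tsuji points of $\mathcal D$. Then $$\lim_{q\to\infty}\max_{z\in\mathcal D}\left(\prod_{k=1}^q[z,\eta_{qk}]_{\mathrm h}\right)^{1/q}=\tau(\mathcal D),$$ where $\tau(\mathcal D)$ is the hyperbolic Chebyshev constant of $\mathcal D$. That is, choosing $\mu_k=\eta_{qk}$ in the minimax problem $\min_{\mu_1,\dots,\mu_q\in\mathcal D}\max_{\lambda\in\partial\mathcal D}\prod_{k=1}^q[\lambda,\mu_k]_{\mathrm h}$, the exponential decay rate of its objective function asymptotically approaches $\tau(\mathcal D)$ as $q\to\infty$.
   Context: $\mathbb D=\{z\in\mathbb C:|z|<1\}$. The pseudohyperbolic metric is $[z,\mu]_{\mathrm h}=\left|\frac{z-\mu}{1-\bar\mu z}\right|$ for $z,\mu\in\mathbb D$. The hyperbolic Chebyshev constant of $\mathcal D$ is $$\tau(\mathcal D)=\lim_{q\to\infty}\min_{\mu_1,\dots,\mu_q\in\mathcal D}\max_{z\in\mathcal D}\Big(\prod_{k=1}^q[z,\mu_k]_{\mathrm h}\Big)^{1/q}$$ (the limit always exists). The $q$-th Tsuji points of $\mathcal D$ are points $z_1,\dots,z_q\in\mathcal D$ attaining the maximum in $$\max_{z_1,\dots,z_q\in\mathcal D}\Big\{\prod_{1\le j<k\le q}[z_j,z_k]_{\mathrm h}\Big\}^{1/\binom q2}$$ (the maximization may be restricted to $\partial\mathcal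 D$). It is known that $\tau(\mathcal D)$ equals the hyperbolic transfinite diameter $d(\mathcal D)$, the limit of the last displayed maximum as $q\to\infty$. *)

(* Defs.v *)
From HB Require Import structures.
From mathcomp Require Import all_boot all_order all_algebra.
From mathcomp Require Import all_classical all_reals all_analysis.
From mathcomp Require Import complex.

Set Implicit Arguments.
Unset Strict Implicit.
Unset Printing Implicit Defensive.

Import Order.TTheory GRing.Theory Num.Theory.
Import numFieldNormedType.Exports.

Local Open Scope classical_set_scope.
Local Open Scope ring_scope.

(* Subsets of the complex plane have type [set R[i]^o]: the alias [^o] carries
   the usual topology, that of the norm.  [Normc.normc] is the modulus with
   values in [R], whereas [`|z|] has values in [R[i]]. *)

Definition unit_disk (R : realType) : set R[i]^o :=
  [set z | Normc.normc z < 1].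

Definition continuum (T : topologicalType) (D : set T) : Prop :=
  [/\ D !=set0, compact D & connected D].

Definition boundary (T : topologicalType) (D : set T) : set T :=
  closure D `\` interior D.

Definition phdist (R : realType) (z mu : R[i]) : R :=
  Normc.normc ((z - mu) / (1 - (mu^*)%C * z)).

Definition points_in (R : realType) (D : set R[i]^o) (q : nat)
    (mu : 'I_q -> R[i]^o) : Prop :=
  forall k, D (mu k).

Definition phprod (R : realType) (q : nat) (mu : 'I_q -> R[i]^o)
    (z : R[i]^o) : R :=
  \prod_(k < q) phdist z (mu k).

(* For [D] nonempty and compact in the unit disk and points [mu] in [D], the
   supremum here and the infimum in [cheb_min] are attained, by continuity:
   they are a maximum and a minimum. *)
Definition cheb_max (R : realType) (D : set R[i]^o) (q : nat)
    (mu : 'I_q -> R[i]^o) : R :=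
  sup [set phprod mu z `^ (q%:R^-1) | z in D].

Definition cheb_min (R : realType) (D : set R[i]^o) (q : nat) : R :=
  inf [set cheb_max D mu | mu in @points_in R D q].

Definition chebyshev_constant (R : realType) (D : set R[i]^o) : R :=
  limn (cheb_min D).

Definition tsuji_mean (R : realType) (q : nat) (z : 'I_q -> R[i]^o) : R :=
  (\prod_(j < q) \prod_(k < q | (j < k)%N) phdist (z j) (z k))
    `^ ('C(q, 2)%:R^-1).

Definition tsuji_points (R : realType) (D : set R[i]^o) (q : nat)
    (eta : 'I_q -> R[i]^o) : Prop :=
  points_in D eta /\
  forall w : 'I_q -> R[i]^o, points_in D w -> tsuji_mean w <= tsuji_mean eta.

(* Again a maximum: the boundary of a nonempty compact set of the plane is
   itself nonempty and compact. *)
Definition minimax_objective (R : realType) (D : set R[i]^o) (q : nat)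
    (mu : 'I_q -> R[i]^o) : R :=
  sup [set phprod mu lambda | lambda in boundary D].

(* Main.v *)
(* Write [F z] for the product of the distances from [z] to [q]-th Tsuji points,
   and [B] for any Blaschke product of degree [q].  The key is an inequality
   valid for all distinct points [z_0, ..., z_q] of the disk:

     1 <= \sum_i |B z_i| / \prod_(j != i) [z_j, z_i]_h.

   Analytically this is Rouche's theorem: otherwise the obvious interpolant of
   [B] at the [q + 1] points would have modulus < 1 on the circle, and would
   agree with [B] at [q] points of the disk at most.  The proof is algebraic: it
   uses the positive form with matrix [1 / (1 - z_i conj(z_j))], on which
   multiplication by the values of a Blaschke product is a contraction, isometric
   on a subspace of codimension at most [q].

   Multiplying by the product of all mutual distances and taking for
   [z_0, ..., z_q] a point [z] of [D] and the Tsuji points, whose product of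
   mutual distances is maximal, gives [F z <= (q + 1) max_D |B|].  With [B] a
   power of the Blaschke product of an arbitrary fixed [mu_1, ..., mu_n] in [D],
   the limsup of [max F `^ (1/q)] is at most [cheb_max D mu].  Hence [cheb_max]
   at the Tsuji points and [cheb_min], which is below it, both tend to the
   infimum of [cheb_max D mu] over all [n] and [mu].  Connectedness of [D] makes
   the maximal product positive, unless [D] is a point.  The second limit
   follows from the first by the maximum principle. *)

Require Import Defs.
From HB Require Import structures.
From mathcomp Require Import all_boot all_order all_algebra.
From mathcomp Require Import all_classical all_reals all_analysis.
From mathcomp Require Import complex ring lra.

Set Implicit Arguments.
Unset Strict Implicit.
Unset Printing Implicit Defensive.

Import Order.TTheory GRing.Theory Num.Theory.
Import numFieldNormedType.Exports.

Local Open Scope classical_set_scope.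
Local Open Scope ring_scope.

(** * The interpolation inequality for Blaschke products *)

Definition blaschke (C : numClosedFieldType) (a z : C) : C :=
  (z - a) / (1 - a^* * z).

Definition blaschke_prod (C : numClosedFieldType) (s : seq C) (z : C) : C :=
  \prod_(a <- s) blaschke a z.

(** For points of the disk this is the squared Hardy space norm of the combination of Szego kernels
    at the [z i] with the conjugates of the [c i] as coefficients. Multiplying [c] by the values of
    [B] is then the adjoint of multiplication by [B]. *)
Definition szego_form (C : numClosedFieldType) (m : nat) (z c : 'I_m -> C) : C :=
  \sum_i \sum_j c i * (c j)^* / (1 - z i * (z j)^*).

Lemma one_sub_conjM_neq0 (C : numClosedFieldType) (a z : C) :
  `|a| < 1 -> `|z| < 1 -> 1 - a^* * z != 0.
Proof.
move=> a1 z1; rewrite subr_eq0; apply/eqP => /(congr1 (fun x => `|x|)).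
rewrite normr1 normrM norm_conjC => e.
suff : `|a| * `|z| < 1 by rewrite -e ltxx.
by rewrite mulr_ilt1.
Qed.

(** With [b = blaschke a], [1 - b(z) conj(b(w))] is [1 - |a|^2] times [1 - z conj(w)], divided by
    [1 - conj(a) z] and by [1 - a conj(w)]. The Szego denominator cancels, so the defect has rank
    one. *)
Lemma szego_form_blaschke (C : numClosedFieldType) (m : nat) (z c : 'I_m -> C) (a : C) :
  `|a| < 1 -> (forall i, `|z i| < 1) ->
  szego_form z c - szego_form z (fun i => blaschke a (z i) * c i) =
  (1 - `|a| ^+ 2) * `|\sum_i c i / (1 - a^* * z i)| ^+ 2.
Proof.
move=> a1 z1; rewrite !normCK rmorph_sum mulr_suml mulr_sumr -sumrB.
apply: eq_bigr => i _; rewrite !mulr_sumr -sumrB; apply: eq_bigr => j _.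
have hi := one_sub_conjM_neq0 a1 (z1 i).
have hij := one_sub_conjM_neq0 (z1 j) (z1 i).
have hj : 1 - a * (z j)^* != 0.
  by have := one_sub_conjM_neq0 a1 (z1 j);
    rewrite -conjC_eq0 rmorphB rmorph1 rmorphM /= conjCK.
rewrite /blaschke !rmorphM !fmorphV !rmorphB !rmorph1 !rmorphM /= !conjCK.
rewrite [z i * _]mulrC.
by field; rewrite hi hij hj.
Qed.

Lemma eq_szego_form (C : numClosedFieldType) (m : nat) (z c d : 'I_m -> C) :
  c =1 d -> szego_form z c = szego_form z d.
Proof. by move=> cd; apply: eq_bigr => i _; apply: eq_bigr => j _; rewrite !cd. Qed.

Lemma szego_form_blaschke_prod_le (C : numClosedFieldType) (m : nat)
    (s : seq C) (z c : 'I_m -> C) :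
  (forall a, a \in s -> `|a| < 1) -> (forall i, `|z i| < 1) ->
  szego_form z (fun i => blaschke_prod s (z i) * c i) <= szego_form z c.
Proof.
move=> s1 z1; elim: s c s1 => [|a s IH] c s1.
  by rewrite (@eq_szego_form _ _ _ _ c) // => i; rewrite /blaschke_prod big_nil mul1r.
have a1 : `|a| < 1 by rewrite s1 ?mem_head.
rewrite (@eq_szego_form _ _ _ _
  (fun i => blaschke_prod s (z i) * (blaschke a (z i) * c i))); last first.
  by move=> i; rewrite /blaschke_prod big_cons mulrAC mulrC mulrA.
apply: le_trans (IH _ _) _ => [b bs|]; first by rewrite s1 // inE bs orbT.
by rewrite -subr_ge0 szego_form_blaschke // mulr_ge0 ?exprn_ge0 // subr_ge0 exprn_ile1 // ltW.
Qed.

(** A factor preserves the form once its rank-one defect vanishes, which is one linear condition on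
    [c]. The columns of [A] collect these conditions. *)
Lemma szego_form_blaschke_prod_eq (C : numClosedFieldType) (m : nat)
    (s : seq C) (z : 'I_m -> C) :
  (forall a, a \in s -> `|a| < 1) -> (forall i, `|z i| < 1) ->
  exists A : 'M[C]_(m, size s), forall c : 'rV[C]_m, c *m A = 0 ->
    szego_form z (fun i => blaschke_prod s (z i) * c 0 i) = szego_form z (c 0).
Proof.
move=> s1 z1; elim: s s1 => [|a s IH] s1.
  exists 0 => c _; apply: eq_szego_form => i.
  by rewrite /blaschke_prod big_nil mul1r.
have a1 : `|a| < 1 by rewrite s1 ?mem_head.
have [b bs|A hA] := IH; first by rewrite s1 // inE bs orbT.
pose w : 'rV[C]_m := \row_i blaschke a (z i).
(* First the condition for [a], then those for [s], imposed on [c] multiplied by the values of the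
   factor at [a]. *)
pose B : 'M[C]_(m, 1 + size s) := row_mx (\col_i (1 - a^* * z i)^-1) (diag_mx w *m A).
exists B => c cB; have {cB} : c *m B = 0 := cB.
rewrite mul_mx_row -[RHS]row_mx0 => /eq_row_mx[c0 cA].
have := hA (c *m diag_mx w); rewrite -mulmxA cA => /(_ erefl) e.
transitivity (szego_form z ((c *m diag_mx w) 0)).
  rewrite -e; apply: eq_szego_form => i; rewrite /blaschke_prod big_cons.
  by rewrite mul_mx_diag !mxE mulrAC mulrC [_ * c 0 i]mulrC mulrA.
rewrite (@eq_szego_form _ _ _ _ (fun i => blaschke a (z i) * c 0 i)); last first.
  by move=> i; rewrite mul_mx_diag !mxE mulrC.
apply/esym/eqP; rewrite -subr_eq0 szego_form_blaschke //.
have := congr1 (fun M : 'M[C]_1 => M 0 0) c0; rewrite !mxE => e0.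
rewrite (_ : \sum_i _ = 0) ?normr0 ?expr0n ?mulr0 // -[RHS]e0.
by apply: eq_bigr => i _; rewrite !mxE.
Qed.

Lemma szego_form_blaschke_prod_fixed (C : numClosedFieldType) (m : nat)
    (s : seq C) (z : 'I_m -> C) :
  (forall a, a \in s -> `|a| < 1) -> (forall i, `|z i| < 1) -> (size s < m)%N ->
  exists2 c : 'I_m -> C, exists i, c i != 0 &
    szego_form z (fun i => blaschke_prod s (z i) * c i) = szego_form z c.
Proof.
move=> s1 z1 sm; have [A hA] := szego_form_blaschke_prod_eq s1 z1.
have kA0 : kermx A != 0.
  rewrite -mxrank_eq0 mxrank_ker subn_eq0 -ltnNge.
  exact: leq_ltn_trans (rank_leq_col A) sm.
exists (nz_row (kermx A) 0); last by apply/hA/sub_kermxP/nz_row_sub.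
apply/existsP; rewrite -negb_forall; move: kA0; rewrite -nz_row_eq0.
apply: contra => /forallP h; apply/eqP/rowP => i; rewrite mxE; exact/eqP/h.
Qed.

Lemma szego_kernel_normB (C : numClosedFieldType) (z w : C) :
  `|1 - z * w^*| ^+ 2 - `|z - w| ^+ 2 = (1 - `|z| ^+ 2) * (1 - `|w| ^+ 2).
Proof. by rewrite !normCK !rmorphB rmorph1 rmorphM /= conjCK; ring. Qed.

Lemma norm_blaschke_le1 (C : numClosedFieldType) (a z : C) :
  `|a| < 1 -> `|z| < 1 -> `|blaschke a z| <= 1.
Proof.
move=> a1 z1; rewrite normrM normfV ler_pdivrMr ?normr_gt0 ?one_sub_conjM_neq0 //.
rewrite mul1r [a^* * z]mulrC -(@ler_pXn2r _ 2) ?nnegrE // -subr_ge0 szego_kernel_normB.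
by rewrite mulr_ge0 // subr_ge0 exprn_ile1 // ltW.
Qed.

(** Points outnumber zeros, so some nonzero [c] has its form unchanged by [B]. Contractivity bounds
    each [c i] by the form. Inserting these bounds into the form of [B c] yields at most the form
    times the square of the sum, so the sum is at least 1. *)
Lemma blaschke_prod_interpolation (C : numClosedFieldType) (m : nat)
    (s : seq C) (z : 'I_m -> C) :
  (forall a, a \in s -> `|a| < 1) -> (forall i, `|z i| < 1) -> (size s < m)%N ->
  injective z ->
  1 <= \sum_i `|blaschke_prod s (z i)| / \prod_(j | j != i) `|blaschke (z j) (z i)|.
Proof.
move=> s1 z1 sm zI.
have [c [k ck0] cfix] := szego_form_blaschke_prod_fixed s1 z1 sm.
(* [p i] is the modulus at [z i] of the Blaschke product vanishing at the other points; [1 / h i] is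
   the norm of the Szego kernel at [z i]. *)
pose p i := \prod_(j | j != i) `|blaschke (z j) (z i)|.
pose h i := sqrtC (1 - `|z i| ^+ 2).
have h2 i : h i ^+ 2 = 1 - `|z i| ^+ 2 by rewrite sqrtCK.
have h0 i : 0 < h i by rewrite sqrtC_gt0 subr_gt0 exprn_ilt1.
have p0 i : 0 < p i.
  apply: prodr_gt0 => j ji; rewrite normr_gt0 mulf_neq0 ?invr_eq0 ?one_sub_conjM_neq0 //.
  by rewrite subr_eq0 (inj_eq zI) eq_sym.
(* The Blaschke product with zeros at all the other points isolates [c i]. *)
have lb i : (`|c i| * p i / h i) ^+ 2 <= szego_form z c.
  have := @szego_form_blaschke_prod_le _ _ [seq z j | j <- enum 'I_m & j != i] z c.
  move=> /(_ _ z1) H; apply: le_trans (H _) => [|_ /mapP[j _ ->] //].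
  rewrite le_eqVlt; apply/orP; left; apply/eqP/esym; rewrite /szego_form.
  have w0 j : j != i ->
      blaschke_prod [seq z j | j <- enum 'I_m & j != i] (z j) = 0.
    move=> ji; rewrite /blaschke_prod big_map big_filter big_enum_cond /= (bigD1 j) //=.
    by rewrite /blaschke subrr !mul0r.
  rewrite (bigD1 i) //= [X in _ + X]big1 ?addr0; last first.
    by move=> j ji; rewrite (w0 j) //; rewrite big1 // => l _; rewrite !mul0r.
  rewrite (bigD1 i) //= [X in _ + X]big1 ?addr0; last first.
    by move=> j ji; rewrite (w0 j) // !(mul0r, rmorph0, mulr0).
  rewrite -normCK -normCK -h2 normrM expr_div_n; congr (_ ^+ 2 / _).
  rewrite mulrC; congr (_ * _).
  by rewrite /blaschke_prod big_map big_filter big_enum_cond /= normr_prod.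
pose g := sqrtC (szego_form z c).
have G0 : 0 < szego_form z c.
  by apply: lt_le_trans (lb k); rewrite exprn_gt0 // divr_gt0 ?mulr_gt0 ?normr_gt0.
have g0 : 0 < g by rewrite sqrtC_gt0.
have lbg i : `|c i| / h i <= g / p i.
  rewrite ler_pdivlMr // mulrAC -(@ler_pXn2r _ 2) ?nnegrE ?(ltW g0) //.
    by rewrite sqrtCK.
  by rewrite !mulr_ge0 ?invr_ge0 ?(ltW (h0 _)) ?(ltW (p0 _)).
pose S := \sum_i `|blaschke_prod s (z i)| / p i.
have S0 : 0 <= S by apply: sumr_ge0 => i _; rewrite divr_ge0 // (ltW (p0 i)).
suff : g ^+ 2 <= (S * g) ^+ 2.
  by rewrite ler_pXn2r ?nnegrE ?mulr_ge0 ?(ltW g0) // ler_pMl.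
rewrite [leLHS]sqrtCK -(ger0_norm (ltW G0)) -cfix /szego_form.
apply: le_trans (ler_norm_sum _ _ _) _.
have -> : (S * g) ^+ 2 = \sum_i \sum_j
    (`|blaschke_prod s (z i)| * (g / p i)) * (`|blaschke_prod s (z j)| * (g / p j)).
  rewrite expr2 /S mulr_suml mulr_suml; apply: eq_bigr => i _; rewrite mulr_sumr.
  by apply: eq_bigr => j _; rewrite ![_ * (g / _)]mulrA ![_ * g / _]mulrAC.
apply: ler_sum => i _; apply: le_trans (ler_norm_sum _ _ _) _; apply: ler_sum => j _.
(* Cauchy-Schwarz for the kernel: an entry is at most the geometric mean of the two diagonal
   ones. *)
have hK : h i * h j <= `|1 - z i * (z j)^*|.
  rewrite -(@ler_pXn2r _ 2) ?nnegrE ?mulr_ge0 ?(ltW (h0 _)) //.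
  by rewrite exprMn !h2 -szego_kernel_normB gerBl exprn_ge0.
rewrite !normrM normfV norm_conjC normrM.
apply: (@le_trans _ _ (`|blaschke_prod s (z i)| * (`|c i| / h i)
                     * (`|blaschke_prod s (z j)| * (`|c j| / h j)))).
  rewrite [leRHS](_ : _ = `|blaschke_prod s (z i)| * `|c i| *
      (`|blaschke_prod s (z j)| * `|c j|) / (h i * h j)); last first.
    by field; rewrite !gt_eqF.
  by rewrite ler_wpM2l ?mulr_ge0 // lef_pV2 // posrE ?mulr_gt0 // (lt_le_trans _ hK) ?mulr_gt0.
by rewrite ler_pM ?mulr_ge0 ?invr_ge0 ?(ltW (h0 _)) // ler_wpM2l.
Qed.

Lemma ltn_lift (n : nat) (i : 'I_n.+1) (j k : 'I_n) :
  (lift i j < lift i k)%N = (j < k)%N.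
Proof. by rewrite !ltnNge /= leq_bump2. Qed.

(** This expresses each denominator of the interpolation inequality through the product over all
    pairs and the product over the pairs avoiding [i]. *)
Lemma prod_ltn_lift (K : comPzSemiRingType) (q : nat) (f : 'I_q.+1 -> 'I_q.+1 -> K)
    (i : 'I_q.+1) :
  (forall j k, f j k = f k j) ->
  \prod_(j < q.+1) \prod_(k < q.+1 | (j < k)%N) f j k =
  (\prod_(k | k != i) f k i) *
  \prod_(j < q) \prod_(k < q | (j < k)%N) f (lift i j) (lift i k).
Proof.
move=> fC; rewrite (bigD1_ord i) //=.
under [X in _ * X]eq_bigr => j _.
  rewrite big_mkcond (bigD1_ord i) //=.
  under [X in _ * X]eq_bigr => k _ do rewrite (ltn_lift i j k).
  rewrite -big_mkcond; over.
rewrite big_split mulrA; congr (_ * _).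
rewrite big_mkcond (bigD1_ord i) //= ltnn mul1r -big_split.
rewrite [RHS]big_mkcond (bigD1_ord i) //= eqxx mul1r; apply: eq_bigr => j _.
rewrite lift_eqF /=; case: (ltngtP i (lift i j)) => [||/eqP]; rewrite ?mulr1 ?mul1r //.
by move=> /eqP/val_inj e; have := neq_lift i j; rewrite -e eqxx.
Qed.

Lemma norm_blaschkeC (C : numClosedFieldType) (a z : C) :
  `|blaschke a z| = `|blaschke z a|.
Proof.
rewrite !normrM !normfV distrC -[`|1 - z^* * a|]norm_conjC.
by rewrite rmorphB rmorph1 rmorphM /= conjCK [z * _]mulrC.
Qed.

Lemma blaschkezz (C : numClosedFieldType) (z : C) : blaschke z z = 0.
Proof. by rewrite /blaschke subrr mul0r. Qed.

Lemma prod_norm_blaschke_le (C : numClosedFieldType) (q : nat)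
    (s : seq C) (z : 'I_q.+1 -> C) :
  (forall a, a \in s -> `|a| < 1) -> (forall i, `|z i| < 1) -> (size s <= q)%N ->
  \prod_(j < q.+1) \prod_(k < q.+1 | (j < k)%N) `|blaschke (z k) (z j)| <=
  \sum_i `|blaschke_prod s (z i)| *
    \prod_(j < q) \prod_(k < q | (j < k)%N) `|blaschke (z (lift i k)) (z (lift i j))|.
Proof.
move=> s1 z1 sq; pose f j k := `|blaschke (z k) (z j)|.
have fC j k : f j k = f k j by exact: norm_blaschkeC.
pose V : C := \prod_(j < q.+1) \prod_(k < q.+1 | (j < k)%N) f j k.
have VE i : V = (\prod_(k | k != i) f k i) *
  \prod_(j < q) \prod_(k < q | (j < k)%N) f (lift i j) (lift i k) := prod_ltn_lift i fC.
(* If two points coincide, the left side is zero. *)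
have [zI|/injectivePn[i [j ij eij]]] := boolP (injectiveb z); last first.
  rewrite [leLHS](VE i) (bigD1 j) 1?eq_sym //= {1}/f eij blaschkezz normr0 !mul0r.
  by apply: sumr_ge0 => k _; rewrite mulr_ge0 ?prodr_ge0 // => ? _; rewrite prodr_ge0.
have := blaschke_prod_interpolation s1 z1 sq (injectiveP _ zI).
have V0 : 0 <= V by do 2!apply: prodr_ge0 => ? _; exact: normr_ge0.
move=> /(ler_wpM2r V0); rewrite mul1r => /le_trans; apply.
rewrite mulr_suml; apply: ler_sum => i _; rewrite -mulrA ler_wpM2l //.
rewrite (VE i) mulrA; under eq_bigr do rewrite norm_blaschkeC.
set p := \prod_(_ | _) _; have [->|p0] := eqVneq p 0.
  by rewrite mulr0 mul0r; do 2!apply: prodr_ge0 => ? _; exact: normr_ge0.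
by rewrite mulVf // mul1r.
Qed.

(** * The maximum principle *)

Lemma continuous_normc (R : realType) : continuous (@Normc.normc R : R[i]^o -> R).
Proof.
move=> z; apply/(cvgrPdist_lt (F := nbhs (z : R[i]^o))) => e e0.
have e0' : (0 : R[i]) < e%:C%C by rewrite ltcR.
have := nbhsx_ballx z _ e0'; apply: filterS => w.
rewrite -ball_normE /= ltcR; apply: le_lt_trans.
rewrite ler_norml; apply/andP; split.
- rewrite lerNl opprB lerBlDr -[Normc.normc (z - w)]normcN opprB.
  by rewrite -[X in Normc.normc X <= _](subrK z w) le_normcD.
- by rewrite lerBlDr -[X in Normc.normc X <= _](subrK w z) le_normcD.
Qed.

Lemma continuous_horner_regular (K : numFieldType) (p : {poly K}) :
  continuous (horner p : K^o -> K^o).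
Proof.
elim/poly_ind: p => [|p c IH] z.
  rewrite (_ : horner _ = cst 0); last by apply/funext => x; rewrite horner0.
  exact: (@cst_continuous K^o K^o).
rewrite (_ : horner _ = fun x => p.[x] * x + c); last first.
  by apply/funext => x; rewrite hornerMXaddC.
apply: (@cvgD _ K^o _ (nbhs (z : K^o)) _ (fun x => p.[x] * x) (cst c)).
  by apply: (@cvgM _ _ (nbhs (z : K^o)) _ (horner p) id); [exact: IH|exact: cvg_id].
exact: (@cst_continuous K^o K^o).
Qed.

Lemma continuous_normc_horner (R : realType) (p : {poly R[i]}) :
  continuous (fun z : R[i]^o => Normc.normc p.[z]).
Proof.
move=> z; apply: (@continuous_comp R[i]^o R[i]^o R (horner p)).
  exact: continuous_horner_regular.
exact: continuous_normc.
Qed.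

(* Expand [P / Q] around [c] to the first order [k] at which it is not constant,
   and move from [c] in a direction in which the [k]-th order term is a positive
   multiple of the value at [c]. *)
Lemma ratio_no_local_max (R : realType) (P Q : {poly R[i]}) (c : R[i]^o) :
  P.[c] != 0 -> Q.[c] != 0 -> P != (P.[c] / Q.[c]) *: Q ->
  ~ \forall z \near c, `|P.[z] / Q.[z]| <= `|P.[c] / Q.[c]|.
Proof.
move=> Pc Qc PQ; set v := P.[c] / Q.[c].
have v0 : v != 0 by rewrite mulf_neq0 ?invr_eq0.
have [k [S Sc PE]] := multiplicity_XsubC (P - v *: Q) c.
rewrite subr_eq0 PQ /= in Sc.
have k0 : (0 < k)%N.
  rewrite lt0n; apply/eqP => k0; move: PE; rewrite k0 expr0 mulr1 => PE.
  by move: Sc; rewrite -PE rootE hornerD hornerN hornerZ divfK // subrr eqxx.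
(* This root makes [S.[c] * u ^+ k] equal to [v * Q.[c]]. *)
pose u := k.-root (v * Q.[c] / S.[c]).
have uk : u ^+ k = v * Q.[c] / S.[c] by rewrite rootCK.
(* [T] measures the deviation from this relation away from [c]. It vanishes at [c], so [Q] dominates
   it nearby. *)
pose T := (Q.[c] / S.[c]) *: S - Q.
have Tc : T.[c] = 0 by rewrite hornerD hornerN hornerZ divfK ?subrr.
have key t : `|T.[c + t * u]| < `|Q.[c + t * u]| -> 0 < t ->
    `|v| < `|P.[c + t * u] / Q.[c + t * u]|.
  set z := c + t * u => TQ t0.
  have Pz : P.[z] = v * ((1 + t ^+ k) * Q.[z] + t ^+ k * T.[z]).
    have := congr1 (horner^~ z) PE.
    rewrite hornerD hornerN hornerZ hornerM horner_exp hornerXsubC.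
    move=> /(canRL (subrK _)) ->.
    have -> : z - c = t * u by rewrite /z addrAC subrr add0r.
    rewrite exprMn uk /T hornerD hornerN hornerZ.
    by ring.
  have Qz0 : 0 < `|Q.[z]| by apply: le_lt_trans TQ.
  rewrite [`|_ / Q.[z]|]normrM normfV ltr_pdivlMr // Pz [`|v * _|]normrM ltr_pM2l ?normr_gt0 //.
  have tk : 0 < t ^+ k by rewrite exprn_gt0.
  apply: lt_le_trans (lerB_normD _ _).
  rewrite [X in X - _]normrM [X in _ - X]normrM (gtr0_norm tk) gtr0_norm ?addr_gt0 //.
  rewrite mulrDl mul1r -addrA.
  by rewrite ltrDl -mulrBr mulr_gt0 // subr_gt0.
move=> Pmax.
have near0 : \forall z \near c, `|T.[z]| < `|Q.[z]|.
  have : Normc.normc T.[c] < Normc.normc Q.[c].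
    have E (x : R[i]) : ((Normc.normc x)%:C)%C = `|x| by [].
    by rewrite -ltcR !E Tc normr0 normr_gt0.
  rewrite -subr_gt0.
  have h : {for c, continuous (fun z : R[i]^o => Normc.normc Q.[z] - Normc.normc T.[z])}.
    by apply: continuousB; exact: continuous_normc_horner.
  move=> /(cvgr_gt _ h); apply: filterS => z; rewrite subr_gt0.
  by rewrite -ltcR.
have [e /= e0 he] := (nbhs_ballP (c : R[i]^o) _).1 (filterI Pmax near0).
(* Makes [t * |u|] smaller than [e], so that the moved point stays in the ball. *)
pose t := e / 2 / (1 + `|u|).
have u0 : 0 < 1 + `|u| by rewrite ltr_pwDl.
have t0 : 0 < t by rewrite !divr_gt0.
have [] : `|P.[c + t * u] / Q.[c + t * u]| <= `|v| /\ `|T.[c + t * u]| < `|Q.[c + t * u]|.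
  apply: he; rewrite -ball_normE /= opprD addNKr normrN normrM gtr0_norm // /t.
  rewrite mulrAC ltr_pdivrMr // -subr_gt0.
  rewrite (_ : _ - _ = e + e / 2 * `|u|); last by field.
  by rewrite ltr_pwDl // mulr_ge0 // ltW // divr_gt0.
by move=> le_v /key /(_ t0) /lt_le_trans /(_ le_v); rewrite ltxx.
Qed.

Lemma horner_blaschke_num (C : numClosedFieldType) (s : seq C) (z : C) :
  (\prod_(a <- s) ('X - a%:P)).[z] = \prod_(a <- s) (z - a).
Proof. by rewrite horner_prod; apply: eq_bigr => a _; rewrite hornerXsubC. Qed.

Lemma horner_blaschke_den (C : numClosedFieldType) (s : seq C) (z : C) :
  (\prod_(a <- s) (1 - a^* *: 'X)).[z] = \prod_(a <- s) (1 - a^* * z).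
Proof.
by rewrite horner_prod; apply: eq_bigr => a _; rewrite !hornerE.
Qed.

Lemma blaschke_prodE (C : numClosedFieldType) (s : seq C) (z : C) :
  blaschke_prod s z =
  (\prod_(a <- s) ('X - a%:P)).[z] / (\prod_(a <- s) (1 - a^* *: 'X)).[z].
Proof.
by rewrite horner_blaschke_num horner_blaschke_den -prodf_div.
Qed.

Lemma blaschke_den_neq0 (C : numClosedFieldType) (s : seq C) (z : C) :
  (forall a, a \in s -> `|a| < 1) -> `|z| < 1 ->
  (\prod_(a <- s) (1 - a^* *: 'X)).[z] != 0.
Proof.
move=> s1 z1; rewrite horner_blaschke_den prodf_seq_neq0; apply/allP => a /s1 a1.
exact: one_sub_conjM_neq0.
Qed.

Lemma phprodE (R : realType) (q : nat) (mu : 'I_q -> R[i]^o) (z : R[i]^o) :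
  phprod mu z = Normc.normc (blaschke_prod (codom mu) z).
Proof.
apply: (@complexI R); rewrite rmorph_prod /=.
rewrite [RHS](_ : _ = `|blaschke_prod (codom mu) z|) // normr_prod.
by rewrite big_map big_enum.
Qed.

Lemma unit_disk_normr (R : realType) (z : R[i]^o) : unit_disk z -> `|z : R[i]| < 1.
Proof. by rewrite /unit_disk /= -ltcR. Qed.

(** Dividing out the zero at [c] leaves a factor that is nonzero near [c]. *)
Lemma poly_not_locally0 (R : realType) (p : {poly R[i]}) (c : R[i]^o) :
  p != 0 -> ~ \forall z \near c, p.[z] = 0.
Proof.
move=> p0 near0; have [k [S Sc pE]] := multiplicity_XsubC p c.
rewrite p0 /= rootE -normr_gt0 in Sc.
have nearS : \forall z \near c, 0 < Normc.normc S.[z].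
  apply: (cvgr_gt _ (@continuous_normc_horner R S c)).
  by rewrite -ltcR.
have [e /= e0 he] := (nbhs_ballP (c : R[i]^o) _).1 (filterI near0 nearS).
have e2 : 0 < e / 2 by rewrite divr_gt0.
have [] : p.[c + e / 2] = 0 /\ 0 < Normc.normc S.[c + e / 2].
  apply: he; rewrite -ball_normE /= opprD addNKr normrN gtr0_norm //.
  by rewrite ltr_pdivrMr // ltr_pMr // ltr1n.
rewrite pE hornerM horner_exp hornerXsubC [c + _]addrC addrK => /eqP.
rewrite mulf_eq0 expf_eq0 (gt_eqF e2) andbF orbF => /eqP ->.
by rewrite -ltcR [X in _ < X](_ : _ = `|0 : R[i]|) // normr0 ltxx.
Qed.

Lemma continuous_phprod (R : realType) (q : nat) (mu : 'I_q -> R[i]^o) (z : R[i]^o) :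
  (forall k, unit_disk (mu k)) -> unit_disk z -> {for z, continuous (phprod mu)}.
Proof.
move=> mu1 z1.
pose P : {poly R[i]} := \prod_(a <- codom mu) ('X - a%:P).
pose Q : {poly R[i]} := \prod_(a <- codom mu) (1 - a^* *: 'X).
rewrite (_ : phprod mu = fun z => Normc.normc P.[z] / Normc.normc Q.[z]); last first.
  by apply/funext => w; rewrite phprodE blaschke_prodE Normc.normcM Normc.normcV.
apply: continuousM; first exact: continuous_normc_horner.
apply: continuousV; last exact: continuous_normc_horner.
apply/eqP => /Normc.eq0_normc/eqP; apply/negP.
apply: blaschke_den_neq0; last exact: unit_disk_normr.
by move=> a /codomP[k ->]; apply: unit_disk_normr.
Qed.

(** A maximiser over [D] lying in the interior would be a local maximum of the modulus of a
    nonconstant quotient of polynomials. *)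
Lemma phprod_le_boundary (R : realType) (D : set R[i]^o) (q : nat)
    (mu : 'I_q -> R[i]^o) (z : R[i]^o) :
  compact D -> D `<=` @unit_disk R -> (forall k, unit_disk (mu k)) ->
  (0 < q)%N -> D z -> exists2 w, boundary D w & phprod mu z <= phprod mu w.
Proof.
move=> Dc D1 mu1 q0 Dz.
have [||c] := @compact_EVT_max _ R (phprod mu) D _ Dc; first by exists z.
  apply: continuous_in_subspaceT => w /set_mem Dw; apply: continuous_phprod => //.
  exact: D1.
rewrite inE => Dc' cmax; exists c; last by apply: cmax; rewrite inE.
split; first exact: subset_closure.
rewrite /= /interior => Dnbhs; have a1 a : a \in codom mu -> `|a : R[i]| < 1.
  by move=> /codomP[k ->]; apply: unit_disk_normr.
pose P : {poly R[i]} := \prod_(a <- codom mu) ('X - a%:P).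
pose Q : {poly R[i]} := \prod_(a <- codom mu) (1 - a^* *: 'X).
have Qc : Q.[c] != 0 by apply: blaschke_den_neq0 => //; apply/unit_disk_normr/D1.
have PQmax : \forall w \near c, `|P.[w] / Q.[w]| <= `|P.[c] / Q.[c]|.
  apply: filterS Dnbhs => w Dw; rewrite -!blaschke_prodE.
  by rewrite lecR -!phprodE; apply: cmax; rewrite inE.
(* [P] vanishes at [mu k] and [Q] does not, so a constant ratio would be 0; but [P] is monic. *)
have PvQ v : P != v *: Q.
  apply/eqP => PvQ; pose k := Ordinal q0.
  have : P.[mu k] = 0.
    apply/eqP; rewrite horner_blaschke_num prodf_seq_eq0; apply/hasP.
    by exists (mu k); rewrite ?codom_f //= subrr.
  rewrite PvQ hornerZ => /eqP; rewrite mulf_eq0 (negPf (blaschke_den_neq0 a1 _)); last first.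
    exact: unit_disk_normr.
  rewrite orbF => /eqP v0; move: (monic_prod_XsubC (codom mu) predT id).
  by rewrite -/P PvQ v0 scale0r monicE lead_coef0 eq_sym oner_eq0.
(* A local maximum of value 0 would force [P] to vanish near [c]. *)
have [Pc|Pc] := eqVneq P.[c] 0; last exact: (ratio_no_local_max Pc Qc (PvQ _) PQmax).
have P0 : P != 0 by have := PvQ 0; rewrite scale0r.
apply: (@poly_not_locally0 _ P c P0).
apply: filterS (filterI Dnbhs PQmax) => w [Dw].
rewrite Pc mul0r normr0 normr_le0 mulf_eq0 invr_eq0 (negPf (blaschke_den_neq0 a1 _)) ?orbF.
  by move=> /eqP.
exact/unit_disk_normr/D1.
Qed.

(** * Tsuji points *)

Lemma normc_ge0 (R : realType) (z : R[i]) : 0 <= Normc.normc z.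
Proof. by rewrite -lecR; exact: (normr_ge0 z). Qed.

Lemma phdist_ge0 (R : realType) (z w : R[i]) : 0 <= phdist z w.
Proof. exact: normc_ge0. Qed.

Lemma phdist_gt0 (R : realType) (z w : R[i]^o) :
  unit_disk z -> unit_disk w -> z != w -> 0 < phdist z w.
Proof.
move=> /unit_disk_normr z1 /unit_disk_normr w1 zw.
rewrite -ltcR [X in _ < X](_ : _ = `|blaschke w z|) // normr_gt0.
by rewrite mulf_neq0 ?invr_eq0 ?one_sub_conjM_neq0 // subr_eq0.
Qed.

Lemma phdistC (R : realType) (z w : R[i]) : phdist z w = phdist w z.
Proof. by apply: (@complexI R); exact: norm_blaschkeC. Qed.

Lemma phdistzz (R : realType) (z : R[i]) : phdist z z = 0.
Proof. by apply: (@complexI R); rewrite [LHS](_ : _ = `|blaschke z z|) // blaschkezz normr0. Qed.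

Lemma phprod_ge0 (R : realType) (q : nat) (mu : 'I_q -> R[i]^o) (z : R[i]^o) :
  0 <= phprod mu z.
Proof. by rewrite phprodE normc_ge0. Qed.

Lemma phprod_le1 (R : realType) (q : nat) (mu : 'I_q -> R[i]^o) (z : R[i]^o) :
  (forall k, unit_disk (mu k)) -> unit_disk z -> phprod mu z <= 1.
Proof.
move=> mu1 z1; apply: prodr_ile1 => k _; rewrite phdist_ge0 /=.
by rewrite -lecR; apply: norm_blaschke_le1; exact: unit_disk_normr.
Qed.

Definition pair_prod (R : realType) (q : nat) (z : 'I_q -> R[i]^o) : R :=
  \prod_(j < q) \prod_(k < q | (j < k)%N) phdist (z j) (z k).

Lemma pair_prod_ge0 (R : realType) (q : nat) (z : 'I_q -> R[i]^o) : 0 <= pair_prod z.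
Proof. by do 2!apply: prodr_ge0 => ? _; exact: phdist_ge0. Qed.

Lemma pair_prod_gt0 (R : realType) (q : nat) (z : 'I_q -> R[i]^o) :
  (forall k, unit_disk (z k)) -> injective z -> 0 < pair_prod z.
Proof.
move=> z1 zI; apply: prodr_gt0 => j _; apply: prodr_gt0 => k jk.
by apply: phdist_gt0 => //; rewrite (inj_eq zI) -val_eqE ltn_eqF.
Qed.

Lemma pair_prod_le (R : realType) (q : nat) (s : seq R[i]) (z : 'I_q.+1 -> R[i]^o) :
  (forall a : R[i]^o, a \in s -> unit_disk a) -> (forall k, unit_disk (z k)) ->
  (size s <= q)%N ->
  pair_prod z <=
  \sum_i Normc.normc (blaschke_prod s (z i)) * pair_prod (z \o lift i).
Proof.
move=> s1 z1 sq; rewrite -lecR /pair_prod.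
have E n (w : 'I_n -> R[i]^o) :
    ((\prod_(j < n) \prod_(k < n | (j < k)%N) phdist (w j) (w k))%:C)%C =
    \prod_(j < n) \prod_(k < n | (j < k)%N) `|blaschke (w k) (w j)|.
  by rewrite rmorph_prod; apply: eq_bigr => j _; rewrite rmorph_prod.
rewrite E rmorph_sum; apply: le_trans (prod_norm_blaschke_le _ _ sq) _.
- by move=> a /s1; exact: unit_disk_normr.
- by move=> k; exact: unit_disk_normr.
by apply: ler_sum => i _; rewrite [leRHS]rmorphM [X in _ <= _ * X]E.
Qed.

Lemma pair_prod_lift0 (R : realType) (q : nat) (z : 'I_q.+1 -> R[i]^o) :
  pair_prod z = phprod (z \o lift ord0) (z ord0) * pair_prod (z \o lift ord0).
Proof.
rewrite /pair_prod (@prod_ltn_lift _ _ (fun j k => phdist (z j) (z k)) ord0).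
  congr (_ * _); rewrite big_mkcond big_ord_recl /= mul1r.
  by apply: eq_bigr => k _; rewrite phdistC.
by move=> j k; exact: phdistC.
Qed.

(** For [1 < q] the exponent in [tsuji_mean] is positive, so the root is strictly increasing and can
    be removed. *)
Lemma tsuji_pair_prod_max (R : realType) (D : set R[i]^o) (q : nat)
    (eta w : 'I_q -> R[i]^o) :
  (1 < q)%N -> tsuji_points D eta -> points_in D w -> pair_prod w <= pair_prod eta.
Proof.
move=> q1 [_ etamax] /etamax; apply: contraTT; rewrite -!ltNge.
apply: gt0_ltr_powR; rewrite ?nnegrE ?pair_prod_ge0 //.
by rewrite invr_gt0 ltr0n bin_gt0.
Qed.

(** The image of [D] under the distance to [a] is an interval containing 0 and the distance from [a]
    to [b]; points at equally spaced distances are distinct. *)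
Lemma connected_injection (R : realType) (D : set R[i]^o) (a b : R[i]^o) (q : nat) :
  connected D -> D a -> D b -> a != b ->
  exists2 w : 'I_q -> R[i]^o, points_in D w & injective w.
Proof.
move=> Dconn Da Db ab; pose f (z : R[i]^o) := Normc.normc (z - a).
have fcont : continuous f.
  have -> : f = (fun z : R[i]^o => Normc.normc ('X - a%:P).[z]).
    by apply/funext => z; rewrite hornerXsubC.
  exact: continuous_normc_horner.
have : connected (f @` D).
  by apply: connected_continuous_connected => //; exact: continuous_subspaceT.
move=> /connected_intervalP fD.
have d0 : 0 < f b.
  by rewrite -ltcR [X in _ < X](_ : _ = `|b - a|) // normr_gt0 subr_eq0 eq_sym.
have fa : f a = 0 by rewrite /f subrr Normc.normc0.
have /choice[w hw] : forall k : 'I_q, exists z, D z /\ f z = f b * (k%:R / q%:R).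
  move=> k; have q0 : 0 < q%:R :> R by rewrite ltr0n (leq_ltn_trans _ (ltn_ord k)).
  have [|||z Dz fz] := fD (f a) (f b) _ _ (f b * (k%:R / q%:R)).
  - by exists a.
  - by exists b.
  - rewrite fa mulr_ge0 ?divr_ge0 ?(ltW d0) //= ger_pMr // ler_pdivrMr // mul1r.
    by rewrite ler_nat ltnW.
  - by exists z.
exists w => [k|j k wjk]; first by have [] := hw k.
have [_ fj] := hw j; have [_ fk] := hw k; apply: val_inj => /=.
have q0 : q%:R != 0 :> R by rewrite pnatr_eq0 -lt0n (leq_ltn_trans _ (ltn_ord j)).
move: fj; rewrite wjk fk => /(mulfI (lt0r_neq0 d0)) /(mulIf (invr_neq0 q0)).
by move=> /eqP; rewrite eqr_nat => /eqP.
Qed.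

Lemma phprod_tsuji_le (R : realType) (D : set R[i]^o) (q : nat)
    (eta : 'I_q -> R[i]^o) (s : seq R[i]) (M : R) (z : R[i]^o) :
  connected D -> D `<=` @unit_disk R -> (1 < q)%N -> tsuji_points D eta ->
  (forall a : R[i]^o, a \in s -> unit_disk a) -> (size s <= q)%N ->
  (forall w : R[i]^o, D w -> Normc.normc (blaschke_prod s w) <= M) ->
  D z -> phprod eta z <= q.+1%:R * M.
Proof.
move=> Dconn D1 q1 tsuji s1 sq sM Dz.
(* If [D] is the single point [z], the Tsuji points equal [z] and the product is zero. *)
have [[b [Db bz]]|/forallNP Dz1] := pselect (exists b, D b /\ b != z); last first.
  pose k : 'I_q := Ordinal (ltnW q1).
  have etak : eta k = z.
    have := Dz1 (eta k); have := tsuji.1 k => Dk h.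
    by apply/eqP/negPn/negP => kz; apply: h.
  rewrite /phprod (bigD1 k) //= etak phdistzz mul0r mulr_ge0 //.
  exact: le_trans (normc_ge0 _) (sM _ Dz).
have [w Dw wI] := connected_injection q Dconn Db Dz bz.
have V0 : 0 < pair_prod eta.
  apply: lt_le_trans (tsuji_pair_prod_max q1 tsuji Dw).
  by apply: pair_prod_gt0 => // k; exact/D1/Dw.
pose W (k : 'I_q.+1) : R[i]^o := oapp eta z (unlift ord0 k).
have W0 : W ord0 = z by rewrite /W unlift_none.
have Wlift : W \o lift ord0 = eta by apply/funext => k; rewrite /W /= liftK.
have DW k : D (W k).
  by rewrite /W; case: (unlift _ _) => [j|] //=; exact: tsuji.1.
have := pair_prod_le s1 (fun k => D1 _ (DW k)) sq.
rewrite pair_prod_lift0 W0 Wlift => hW; rewrite -(ler_pM2r V0).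
apply: le_trans hW _; rewrite -mulrA mulr_natl.
rewrite -[X in _ *+ X](card_ord q.+1) -sumr_const; apply: ler_sum => i _.
apply: ler_pM; [exact: normc_ge0|exact: pair_prod_ge0|exact/sM/DW|].
(* Dropping any one of the [q + 1] points leaves [q] points of [D], which compete with the Tsuji
   points. *)
by apply: (tsuji_pair_prod_max q1 tsuji) => k; exact: DW.
Qed.

(** * Asymptotics *)

Lemma powR_invn_le (R : realType) (a b : R) (n : nat) :
  0 <= a -> 0 <= b -> (0 < n)%N -> (a `^ n%:R^-1 <= b) = (a <= b ^+ n).
Proof.
move=> a0 b0 n0; have n0R : n%:R != 0 :> R by rewrite pnatr_eq0 -lt0n.
have ni0 : 0 < n%:R^-1 :> R by rewrite invr_gt0 ltr0n.
have {1}-> : b = (b ^+ n) `^ n%:R^-1.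
  by rewrite -powR_mulrn // -powRrM mulfV // powRr1.
have bn0 : 0 <= b ^+ n by rewrite exprn_ge0.
apply/idP/idP; last by apply: ge0_ler_powR; rewrite ?nnegrE // ltW.
by apply: contraTT; rewrite -!ltNge; apply: gt0_ltr_powR; rewrite ?nnegrE.
Qed.

Section cheb_max.
Variables (R : realType) (D : set R[i]^o).
Hypotheses (D0 : D !=set0) (D1 : D `<=` @unit_disk R).

Lemma phprod_le_cheb_max (n : nat) (mu : 'I_n -> R[i]^o) (z : R[i]^o) :
  points_in D mu -> D z -> phprod mu z `^ n%:R^-1 <= cheb_max D mu.
Proof.
move=> Dmu Dz; apply: ub_le_sup; last by exists z.
exists 1 => _ [w Dw <-]; case: n => [|n] in mu Dmu *.
  (* With no points the exponent is [0^-1 = 0] and the value is 1. *)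
  by rewrite invr0 powRr0.
rewrite powR_invn_le ?phprod_ge0 // expr1n phprod_le1 //; last exact: D1.
by move=> k; apply: D1.
Qed.

Lemma cheb_max_ge0 (n : nat) (mu : 'I_n -> R[i]^o) :
  points_in D mu -> 0 <= cheb_max D mu.
Proof.
move=> Dmu; have [z Dz] := D0.
exact: le_trans (powR_ge0 _ _) (phprod_le_cheb_max Dmu Dz).
Qed.

Lemma cheb_max_le (n : nat) (mu : 'I_n -> R[i]^o) (r : R) :
  (0 < n)%N -> 0 <= r -> (forall z, D z -> phprod mu z <= r ^+ n) ->
  cheb_max D mu <= r.
Proof.
move=> n0 r0 h; apply: ge_sup => [|_ [z Dz <-]].
  by have [z Dz] := D0; exists (phprod mu z `^ n%:R^-1), z.
by rewrite powR_invn_le ?phprod_ge0 // h.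
Qed.

Lemma cheb_max_le1 (n : nat) (mu : 'I_n -> R[i]^o) :
  (0 < n)%N -> points_in D mu -> cheb_max D mu <= 1.
Proof.
move=> n0 Dmu; apply: cheb_max_le => // z Dz; rewrite expr1n phprod_le1 //.
- by move=> k; apply: D1.
- exact: D1.
Qed.

Lemma phprod_le_expr_cheb_max (n : nat) (mu : 'I_n -> R[i]^o) (z : R[i]^o) :
  (0 < n)%N -> points_in D mu -> D z -> phprod mu z <= cheb_max D mu ^+ n.
Proof.
move=> n0 Dmu Dz; rewrite -powR_invn_le ?phprod_ge0 ?cheb_max_ge0 //.
exact: phprod_le_cheb_max.
Qed.

Lemma cheb_min_le (n : nat) (mu : 'I_n -> R[i]^o) :
  points_in D mu -> cheb_min D n <= cheb_max D mu.
Proof.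
move=> Dmu; apply: ge_inf; last by exists mu.
by exists 0 => _ [nu Dnu <-]; exact: cheb_max_ge0.
Qed.

(** The maximum principle replaces [D] by its boundary, and the monotone root passes through the
    supremum. *)
Lemma minimax_objective_powR (n : nat) (mu : 'I_n -> R[i]^o) :
  compact D -> (0 < n)%N -> points_in D mu ->
  minimax_objective D mu `^ n%:R^-1 = cheb_max D mu.
Proof.
move=> Dc n0 Dmu; have mu1 k : unit_disk (mu k) by exact/D1/Dmu.
have [z0 Dz0] := D0.
have [w0 bw0 _] := phprod_le_boundary Dc D1 mu1 n0 Dz0.
have bD : boundary D `<=` D.
  by move=> w [cw _]; apply: compact_closed cw => //; exact: norm_hausdorff.
have ub : has_ubound [set phprod mu w | w in boundary D].
  by exists 1 => _ [w /bD Dw <-]; apply: phprod_le1 => //; exact: D1.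
have m0 : 0 <= minimax_objective D mu.
  by apply: le_trans (phprod_ge0 mu w0) _; apply: ub_le_sup => //; exists w0.
apply/eqP; rewrite eq_le; apply/andP; split.
  rewrite powR_invn_le ?cheb_max_ge0 //; apply: ge_sup.
    by exists (phprod mu w0), w0.
  by move=> _ [w /bD Dw <-]; exact: phprod_le_expr_cheb_max.
apply: cheb_max_le => // [|z Dz]; first exact: powR_ge0.
rewrite -powR_mulrn ?powR_ge0 // -powRrM mulVf ?powRr1 //; last first.
  by rewrite pnatr_eq0 -lt0n.
have [w bw /le_trans] := phprod_le_boundary Dc D1 mu1 n0 Dz; apply.
by apply: ub_le_sup => //; exists w.
Qed.

End cheb_max.

(** Bernoulli's inequality for the square root of [x] bounds [x ^+ q] below by a quadratic in
    [q]. *)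
Lemma near_linear_le_expr (R : realType) (A x : R) :
  0 <= A -> 1 < x -> \forall q \near \oo, A * q.+1%:R <= x ^+ q.
Proof.
move=> A0 x1; pose y := Num.sqrt x; pose t := y - 1.
have x0 : 0 <= x by rewrite ltW // (lt_trans ltr01).
have y1 : 1 < y by rewrite -[ltLHS]sqrtr1 ltr_sqrt // (lt_trans ltr01).
have t0 : 0 < t by rewrite subr_gt0.
have yq q : q%:R * t <= y ^+ q.
  elim: q => [|q IH]; first by rewrite mul0r.
  have : 1 <= y ^+ q by rewrite exprn_ege1 // ltW.
  rewrite exprS (_ : y = 1 + t); last by rewrite /t addrC subrK.
  rewrite (_ : 1 + t = y); last by rewrite /t addrC subrK.
  by rewrite -natr1; move: IH; rewrite /t in t0 *; nra.
(* This threshold gives [q^2 t^2 >= 2 A q >= A (q + 1)] for [q >= 1]. *)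
have : \forall q \near \oo, 2 * A / t ^+ 2 <= q%:R by exact: nbhs_infty_ger.
move=> h; near=> q.
have q1 : 1 <= q%:R :> R by rewrite ler1n; near: q; exact: nbhs_infty_gt.
have : 2 * A / t ^+ 2 <= q%:R by near: q.
rewrite ler_pdivrMr ?exprn_gt0 // => qA.
have : (q%:R * t) ^+ 2 <= x ^+ q.
  rewrite -[x]sqr_sqrtr // -exprM mulnC exprM.
  by rewrite ler_pXn2r ?nnegrE ?yq ?mulr_ge0 ?exprn_ge0 ?sqrtr_ge0 ?(ltW t0).
apply: le_trans; rewrite -natr1 exprMn.
move: qA q1; set Q := q%:R; set T := t ^+ 2; nra.
Unshelve. all: by end_near.
Qed.

Lemma size_flatten_nseq (T : Type) (k : nat) (s : seq T) :
  size (flatten (nseq k s)) = (k * size s)%N.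
Proof. by elim: k => //= k IH; rewrite size_cat IH mulSn. Qed.

Lemma blaschke_prod_flatten_nseq (C : numClosedFieldType) (k : nat) (s : seq C) (z : C) :
  blaschke_prod (flatten (nseq k s)) z = blaschke_prod s z ^+ k.
Proof.
elim: k => [|k IH]; first by rewrite /blaschke_prod big_nil expr0.
by rewrite /= /blaschke_prod big_cat -/(blaschke_prod _ _) -/(blaschke_prod _ _) IH exprS.
Qed.

Lemma cheb_max_tsuji_near (R : realType) (D : set R[i]^o)
    (eta : forall q : nat, 'I_q -> R[i]^o) (n : nat) (mu : 'I_n -> R[i]^o) (r : R) :
  continuum D -> D `<=` @unit_disk R -> (forall q, tsuji_points D (eta q)) ->
  (0 < n)%N -> points_in D mu -> cheb_max D mu < r ->
  \forall q \near \oo, cheb_max D (eta q) <= r.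
Proof.
move=> [D0 Dc Dconn] D1 tsuji n0 Dmu mur.
have rho0 : 0 <= cheb_max D mu := cheb_max_ge0 D0 D1 Dmu.
have r0 : 0 < r := le_lt_trans rho0 mur.
(* For [r >= 1] the bound is trivial; otherwise [t < 1] below, so its powers decrease. *)
have [r1|r1] := leP 1 r.
  near=> q; apply: le_trans r1; apply: cheb_max_le1 => //; last exact: (tsuji q).1.
  by near: q; exact: nbhs_infty_gt.
(* The midpoint is positive even if [cheb_max D mu] is 0, and [r / t > 1] leaves room to absorb the
   factor [q + 1]. *)
pose t := (cheb_max D mu + r) / 2.
have rho_t : cheb_max D mu <= t by rewrite /t; lra.
have tr : t < r by rewrite /t; lra.
have t0 : 0 < t by rewrite /t; lra.
have h : \forall q \near \oo, t ^- n * q.+1%:R <= (r / t) ^+ q.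
  apply: near_linear_le_expr; first by rewrite invr_ge0 exprn_ge0 // ltW.
  by rewrite ltr_pdivlMr // mul1r.
near=> q.
have q1 : (1 < q)%N by near: q; exact: nbhs_infty_gt.
apply: cheb_max_le => //; [exact: ltnW|exact: ltW|] => z Dz.
(* The zeros of the largest power of the Blaschke product of [mu] whose degree is at most [q]. *)
pose s := flatten (nseq (q %/ n) (codom mu)).
apply: (@le_trans _ _ (q.+1%:R * t ^+ (n * (q %/ n)))).
  apply: (@phprod_tsuji_le _ D _ _ s) => //.
  - by move=> a /flattenP[_ /nseqP[-> _] /codomP[k ->]]; exact/D1/Dmu.
  - by rewrite size_flatten_nseq size_codom card_ord leq_trunc_div.
  - move=> w Dw; rewrite blaschke_prod_flatten_nseq.
    have -> : Normc.normc (blaschke_prod (codom mu) w ^+ (q %/ n)) = phprod mu w ^+ (q %/ n).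
      rewrite phprodE; apply: (@complexI R); rewrite rmorphXn /=; exact: normrX.
    rewrite exprM lerXn2r ?nnegrE ?phprod_ge0 ?exprn_ge0 ?(ltW t0) //.
    apply: le_trans (phprod_le_expr_cheb_max D0 D1 n0 Dmu Dw) _.
    by rewrite lerXn2r ?nnegrE // ltW.
(* As [n * (q %/ n)] exceeds [q - n], rounding the degree down costs at most the factor [t ^- n]. *)
have : t ^- n * q.+1%:R <= r ^+ q / t ^+ q by rewrite -expr_div_n; near: q.
rewrite ler_pdivlMr ?exprn_gt0 //; apply: le_trans.
rewrite mulrAC [leRHS]mulrC ler_wpM2l //.
rewrite mulrC ler_pdivlMr ?exprn_gt0 // -exprD ler_wiXn2l ?(ltW t0) //.
  by rewrite ltW // (lt_trans tr).
rewrite {1}(divn_eq q n) mulnC leq_add2l ltnW //; exact: ltn_pmod.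
Unshelve. all: by end_near.
Qed.

Theorem theorem7 (R : realType) (D : set R[i]^o)
    (eta : forall q : nat, 'I_q -> R[i]^o)
    (D_continuum : continuum D)
    (D_disk : D `<=` @unit_disk R)
    (eta_tsuji : forall q : nat, tsuji_points D (eta q)) :
  (cheb_max D (eta q) @[q --> \oo] --> chebyshev_constant D) /\
  ((minimax_objective D (eta q)) `^ (q%:R^-1) @[q --> \oo]
     --> chebyshev_constant D).
Proof.
have [D0 Dc _] := D_continuum.
pose S := [set r | exists n, exists2 mu : 'I_n.+1 -> R[i]^o, points_in D mu & cheb_max D mu = r].
pose L := inf S.
have S_inf : has_inf S.
  split; first by exists (cheb_max D (eta 1)), 0, (eta 1) => //; exact: (eta_tsuji 1).1.
  by exists 0 => _ [n [mu Dmu <-]]; exact: cheb_max_ge0.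
have L_min q : (0 < q)%N -> L <= cheb_min D q.
  case: q => // q _; apply: lb_le_inf.
    by exists (cheb_max D (eta q.+1)), (eta q.+1) => //; exact: (eta_tsuji _).1.
  by move=> _ [mu Dmu <-]; apply: ge_inf => //; [exact: S_inf.2|exists q, mu].
have min_max q : cheb_min D q <= cheb_max D (eta q).
  by apply: cheb_min_le => //; exact: (eta_tsuji q).1.
(* A family [mu] within [e] of the infimum stays fixed while [q] grows. *)
have max_near e : 0 < e -> \forall q \near \oo, cheb_max D (eta q) <= L + e.
  move=> e0; have [_ [n [mu Dmu <-]] muL] := inf_adherent e0 S_inf.
  exact: (@cheb_max_tsuji_near R D eta n.+1 mu).
(* An arbitrary [u] serves both [cheb_min] and the Tsuji values; the first case also shows that the
   limit defining [chebyshev_constant] exists. *)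
have cvgL (u : nat -> R) : (forall q, cheb_min D q <= u q <= cheb_max D (eta q)) ->
    u q @[q --> \oo] --> L.
  move=> hu; apply/cvgrPdist_le => e e0; near=> q.
  have /andP[lo hi] := hu q.
  have Lq : L <= cheb_min D q by apply: L_min; near: q; exact: nbhs_infty_gt.
  have hq : cheb_max D (eta q) <= L + e by near: q; exact: max_near.
  by rewrite ler_norml; lra.
have -> : chebyshev_constant D = L.
  apply: cvg_lim; first exact: norm_hausdorff.
  by apply: cvgL => q; rewrite lexx min_max.
have maxL : cheb_max D (eta q) @[q --> \oo] --> L.
  by apply: cvgL => q; rewrite lexx min_max.
split=> //; apply: cvg_trans maxL; apply: near_eq_cvg; near=> q.
apply/esym/minimax_objective_powR => //; last exact: (eta_tsuji q).1.
by near: q; exact: nbhs_infty_gt.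
Unshelve. all: by end_near.
Qed.
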